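(* Let $p$ be a prime and let $\mathcal{C}$ be a $\mathbb{Z}_p\mathbb{Z}_p[u,v]$-additive cyclic code of length $(\alpha,\beta)$. Let $\Psi:\mathbb{Z}_p^\alpha\times\mathbb{Z}_p[u,v]^\beta\to\mathbb{Z}_p^{\alpha+3\beta}$ be the Gray map sending $(e_0,\dots,e_{\alpha-1},r_0,\dots,r_{\beta-1})$, with $r_i=a_i+ub_i+vc_i$, to $$(e_0,\dots,e_{\alpha-1},\,a_0,\dots,a_{\beta-1},\,a_0+b_0,\dots,a_{\beta-1}+b_{\beta-1},\,a_0+c_0,\dots,a_{\beta-1}+c_{\beta-1}).$$ Then $\Psi(\mathcal{C})$ is 1. a quasi-cyclic code of length $4\alpha$ and index $4$ over $\mathbb{Z}_p$ if $\alpha=\beta$; 2. a generalized quasi-cyclic code of block length $(\alpha,\beta,\beta,\beta)$ over $\mathbb{Z}_p$ if $\alpha\ne\beta$.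
   Context: $R=\mathbb{Z}_p[u,v]$ denotes the ring $\mathbb{Z}_p+u\mathbb{Z}_p+v\mathbb{Z}_p$ with $u^2=v^2=uv=vu=0$; $\rho:R\to\mathbb{Z}_p$, $\rho(a+ub+vc)=a$. A $\mathbb{Z}_p\mathbb{Z}_p[u,v]$-additive code of length $(\alpha,\beta)$ is an $R$-submodule of $\mathbb{Z}_p^\alpha\times R^\beta$, where $z*(c,d)=(\rho(z)c,zd)$; it is additive cyclic if it is closed under $(c_0,\dots,c_{\alpha-1},d_0,\dots,d_{\beta-1})\mapsto(c_{\alpha-1},c_0,\dots,c_{\alpha-2},d_{\beta-1},d_0,\dots,d_{\beta-2})$. With $\sigma$ the cyclic shift $(e_0,\dots,e_{t-1})\mapsto(e_{t-1},e_0,\dots,e_{t-2})$, a linear code over $\mathbb{Z}_p$ of length $st$ is quasi-cyclic (QC) of index $s$ if it is invariant under $(e_0\mid\dots\mid e_{s-1})\mapsto(\sigma(e_0)\mid\dots\mid\sigma(e_{s-1}))$, $e_i\in\mathbb{Z}_p^t$. A generalized QC code of block length $(m_1,\dots,m_\ell)$ over $\mathbb{Z}_p$ is a linear code in $\mathbb{Z}_p^{m_1}\times\dots\times\mathbb{Z}_p^{m_\ell}$ invariant under simultaneously cyclically shifting each of the $\ell$ blocks by one position. *)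

(* Defs.v *)
From HB Require Import structures.
From mathcomp Require Import all_boot all_order all_algebra.

Set Implicit Arguments.
Unset Strict Implicit.
Unset Printing Implicit Defensive.

Import GRing.Theory.
Local Open Scope ring_scope.

(* The ring Z_p[u,v] = Z_p + u Z_p + v Z_p with u^2 = v^2 = uv = vu = 0:
   Zpuv a b c stands for a + u b + v c. As 'F_p is Z/pZ only for p prime,
   all of this file is meant for prime p. *)
Record zpuv (p : nat) := Zpuv { zpa : 'F_p; zpb : 'F_p; zpc : 'F_p }.

Section Ring.
Variable p : nat.
Implicit Types x y z : zpuv p.

Definition zpuv_prod x := (zpa x, zpb x, zpc x).
Definition prod_zpuv (t : 'F_p * 'F_p * 'F_p) := Zpuv t.1.1 t.1.2 t.2.
Lemma zpuv_prodK : cancel zpuv_prod prod_zpuv. Proof. by case. Qed.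

HB.instance Definition _ := Finite.copy (zpuv p) (can_type zpuv_prodK).

Definition zpuv_zero := @Zpuv p 0 0 0.
Definition zpuv_one := @Zpuv p 1 0 0.
Definition zpuv_opp x := Zpuv (- zpa x) (- zpb x) (- zpc x).
Definition zpuv_add x y := Zpuv (zpa x + zpa y) (zpb x + zpb y) (zpc x + zpc y).
Definition zpuv_mul x y :=
  Zpuv (zpa x * zpa y)
       (zpa x * zpb y + zpb x * zpa y)
       (zpa x * zpc y + zpc x * zpa y).

Lemma zpuv_addA : associative zpuv_add.
Proof. by move=> x y z; congr Zpuv; rewrite /= addrA. Qed.
Lemma zpuv_addC : commutative zpuv_add.
Proof. by move=> x y; congr Zpuv; rewrite /= addrC. Qed.
Lemma zpuv_add0 : left_id zpuv_zero zpuv_add.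
Proof. by case=> a b c; congr Zpuv; rewrite /= add0r. Qed.
Lemma zpuv_addN : left_inverse zpuv_zero zpuv_opp zpuv_add.
Proof. by move=> x; congr Zpuv; rewrite /= addNr. Qed.

HB.instance Definition _ := GRing.isZmodule.Build (zpuv p)
  zpuv_addA zpuv_addC zpuv_add0 zpuv_addN.

Lemma zpuv_mulA : associative zpuv_mul.
Proof.
move=> x y z; congr Zpuv; rewrite /= ?mulrA //;
  by rewrite mulrDr mulrDl !mulrA addrA.
Qed.
Lemma zpuv_mulC : commutative zpuv_mul.
Proof.
by move=> x y; congr Zpuv; rewrite /= 1?addrC mulrC // (mulrC (zpa x)).
Qed.
Lemma zpuv_mul1 : left_id zpuv_one zpuv_mul.
Proof. by case=> a b c; congr Zpuv; rewrite /= mul1r ?mul0r ?addr0. Qed.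
Lemma zpuv_mulD : left_distributive zpuv_mul +%R.
Proof.
by move=> x y z; congr Zpuv; rewrite /= !mulrDl // addrACA.
Qed.
Lemma zpuv_oner_neq0 : zpuv_one != 0.
Proof. by apply/eqP=> -[/eqP]; rewrite oner_eq0. Qed.

HB.instance Definition _ := GRing.Zmodule_isComNzRing.Build (zpuv p)
  zpuv_mulA zpuv_mulC zpuv_mul1 zpuv_mulD zpuv_oner_neq0.

Definition zu : zpuv p := Zpuv 0 1 0.
Definition zv : zpuv p := Zpuv 0 0 1.

Lemma zpuv_relations : [/\ zu ^+ 2 = 0, zv ^+ 2 = 0, zu * zv = 0 & zv * zu = 0].
Proof.
by split; congr Zpuv; rewrite /= ?(mul0r, mulr0, addr0).
Qed.

Lemma zpuvE (a b c : 'F_p) :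
  Zpuv a b c = Zpuv a 0 0 + zu * Zpuv b 0 0 + zv * Zpuv c 0 0.
Proof.
by congr Zpuv; rewrite /= ?(mul0r, mulr0, mul1r, addr0, add0r).
Qed.

Definition rho x : 'F_p := zpa x.

End Ring.

(* Z_p^alpha x R^beta. The type is not left as a bare product because its
   scalar multiplication by R acts on the first factor through rho. *)
Definition mixed (p alpha beta : nat) : Type :=
  ('rV['F_p]_alpha * 'rV[zpuv p]_beta)%type.

Section Module.
Variables p alpha beta : nat.

HB.instance Definition _ := Finite.copy (mixed p alpha beta)
  ('rV['F_p]_alpha * 'rV[zpuv p]_beta)%type.
HB.instance Definition _ := GRing.Zmodule.copy (mixed p alpha beta)
  ('rV['F_p]_alpha * 'rV[zpuv p]_beta)%type.

Definition mixed_scale (z : zpuv p) (x : mixed p alpha beta)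
  : mixed p alpha beta := (rho z *: x.1, z *: x.2).

Lemma mixed_scaleA a b x :
  mixed_scale a (mixed_scale b x) = mixed_scale (a * b) x.
Proof. by rewrite /mixed_scale /= !scalerA. Qed.
Lemma mixed_scale1 : left_id 1 mixed_scale.
Proof. by case=> c d; rewrite /mixed_scale /= !scale1r. Qed.
Lemma mixed_scaleDr : right_distributive mixed_scale +%R.
Proof. by move=> a [c d] [c' d']; rewrite /mixed_scale /= !scalerDr. Qed.
Lemma mixed_scaleDl x : {morph mixed_scale^~ x : a b / a + b}.
Proof. by move=> a b; rewrite /mixed_scale /= !scalerDl. Qed.

HB.instance Definition _ := GRing.Zmodule_isLmodule.Build
  (zpuv p) (mixed p alpha beta)
  mixed_scaleA mixed_scale1 mixed_scaleDr mixed_scaleDl.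

End Module.

Lemma mixed_scaleE p alpha beta (z : zpuv p) (c : 'rV['F_p]_alpha)
    (d : 'rV[zpuv p]_beta) :
  z *: ((c, d) : mixed p alpha beta) = (rho z *: c, z *: d).
Proof. by []. Qed.

(* (e_0, ..., e_{n-1}) |-> (e_{n-1}, e_0, ..., e_{n-2}); ord_pred is the
   predecessor modulo n. *)
Definition cshift (T : Type) (n : nat) (e : 'rV[T]_n) : 'rV[T]_n :=
  \row_i e 0 (ord_pred i).

Definition additive_cyclic_code (p alpha beta : nat)
    (C : {set mixed p alpha beta}) : Prop :=
  submod_closed C /\
  (forall x : mixed p alpha beta,
     x \in C -> (cshift x.1, cshift x.2) \in C).

(* Cuts e into consecutive blocks of lengths m_1, ..., m_l and applies
   (x_0, ..., x_{t-1}) |-> (x_{t-1}, x_0, ..., x_{t-2}), i.e. rotr 1, to each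
   of them. Meaningful only when n = sumn m, which the definitions of codes
   below require. *)
Definition block_shift (p : nat) (m : seq nat) (n : nat)
    (e : 'rV['F_p]_n) : 'rV['F_p]_n :=
  \row_j (flatten [seq rotr 1 b | b <- reshape m [seq e 0 i | i : 'I_n]])`_j.

Lemma block_shift1 (p n : nat) (e : 'rV['F_p]_n) :
  block_shift [:: n] e = cshift e.
Proof.
apply/rowP=> j; rewrite !mxE /=.
have sz : size [seq e 0 i | i : 'I_n] = n by rewrite size_map size_enum_ord.
have nthE k (k_lt : (k < n)%N) :
    [seq e 0 i | i : 'I_n]`_k = e 0 (Ordinal k_lt).
  rewrite (nth_map (Ordinal k_lt)) ?size_enum_ord //; congr (e _ _).
  by apply/val_inj; rewrite /= nth_enum_ord.
rewrite cats0 take_oversize ?sz // /rotr /rot sz.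
have n_gt0 : (0 < n)%N by apply: leq_ltn_trans (ltn_ord j).
rewrite nth_cat size_drop sz subKn //.
case: ltnP => [|j_gt0].
  case: j => [[|//] j_lt] _; rewrite nth_drop addn0 nthE ?subn1 ?ltn_predL //.
  move=> n1_lt; congr (e _ _); apply/val_inj => /=.
  by rewrite add0n modn_small ?subn1.
have j1_lt : (j - 1 < n)%N by rewrite (leq_ltn_trans (leq_subr _ _)).
rewrite nth_take ?ltn_sub2r ?(leq_ltn_trans j_gt0) // nthE.
congr (e _ _); apply/val_inj => /=.
rewrite -subn1 -addnBAC // modnDr modn_small //.
Qed.

Definition linear_code (p n : nat) (D : {set 'rV['F_p]_n}) : Prop :=
  submod_closed D.

(* Quasi-cyclic code of length s * t and index s. *)
Definition quasi_cyclic_code (p s t n : nat) (D : {set 'rV['F_p]_n}) : Prop :=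
  [/\ n = (s * t)%N, linear_code D &
      {in D, forall e, block_shift (nseq s t) e \in D}].

(* Generalized quasi-cyclic code of block length m = (m_1, ..., m_l). The
   product of the Z_p^{m_i} is identified with Z_p^(m_1 + ... + m_l). *)
Definition generalized_quasi_cyclic_code (p : nat) (m : seq nat) (n : nat)
    (D : {set 'rV['F_p]_n}) : Prop :=
  [/\ n = sumn m, linear_code D & {in D, forall e, block_shift m e \in D}].

Lemma gray_length alpha beta :
  (alpha + (beta + (beta + beta)) = alpha + 3 * beta)%N.
Proof. by rewrite !mulSn mul0n addn0. Qed.

Definition gray (p alpha beta : nat) (x : mixed p alpha beta)
    : 'rV['F_p]_(alpha + 3 * beta) :=
  let e := x.1 in
  let a := map_mx (@zpa p) x.2 in
  let b := map_mx (@zpb p) x.2 in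
  let c := map_mx (@zpc p) x.2 in
  castmx (erefl, gray_length alpha beta)
    (row_mx e (row_mx a (row_mx (a + b) (a + c)))).

(* Main.v *)
Require Import Defs.
From mathcomp Require Import all_boot all_order all_algebra.

Set Implicit Arguments.
Unset Strict Implicit.
Unset Printing Implicit Defensive.

Import GRing.Theory.
Local Open Scope ring_scope.

(** The Gray map turns the shift of the code into the shift of the four blocks, because [a], [a + b]
    and [a + c] are computed coordinate by coordinate ([gray_cshift]). It is also linear over the
    prime field, embedded in the ring as the constants [Zpuv k 0 0] ([gray_semilinear]). So the
    image of an additive cyclic code is linear and closed under the block shift; equal block lengths
    give the quasi-cyclic case. *)

Lemma enum_ordD (m n : nat) :
  enum 'I_(m + n) = map (@lshift m n) (enum 'I_m) ++ map (@rshift m n) (enum 'I_n).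
Proof.
apply: (inj_map val_inj); rewrite [LHS]val_enum_ord map_cat iotaD.
congr (_ ++ _); first by rewrite -map_comp -val_enum_ord; apply: eq_map.
by rewrite addnC iotaDl -val_enum_ord -!map_comp; apply: eq_map.
Qed.

Lemma codom_row_mx (T : Type) (m n : nat) (e : 'rV[T]_m) (f : 'rV[T]_n) :
  [seq row_mx e f 0 i | i : 'I_(m + n)] =
  [seq e 0 i | i : 'I_m] ++ [seq f 0 i | i : 'I_n].
Proof.
rewrite /image_mem enum_ordD map_cat.
by congr (_ ++ _); rewrite -map_comp; apply: eq_map => i /=; rewrite ?row_mxEl ?row_mxEr.
Qed.

(** Cutting off the first [m] entries recovers exactly [e], so blocks can be peeled off one at a
    time. *)
Lemma block_shift_row_mx (p m n : nat) (s : seq nat)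
    (e : 'rV['F_p]_m) (f : 'rV['F_p]_n) :
  block_shift (m :: s) (row_mx e f) = row_mx (cshift e) (block_shift s f).
Proof.
have sz : size [seq e 0 i | i : 'I_m] = m by rewrite size_map size_enum_ord.
apply/rowP=> j; rewrite mxE codom_row_mx /=.
rewrite take_size_cat // drop_size_cat // nth_cat size_rotr sz.
case: (split_ordP j) => k -> /=.
  (* [block_shift1], read backwards, expresses [cshift e] through the same list rotation. *)
  rewrite row_mxEl -block_shift1 mxE /= cats0 take_oversize //.
  by rewrite sz.
by rewrite row_mxEr mxE addKn.
Qed.

Lemma block_shift_castmx (p : nat) (s : seq nat) (m n : nat) (mn : m = n)
    (e : 'rV['F_p]_m) :
  block_shift s (castmx (erefl, mn) e) = castmx (erefl, mn) (block_shift s e).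
Proof. by case: n / mn; rewrite !castmx_id. Qed.

Lemma gray_cshift (p alpha beta : nat) (x : mixed p alpha beta) :
  gray ((cshift x.1, cshift x.2) : mixed p alpha beta) =
  block_shift [:: alpha; beta; beta; beta] (gray x).
Proof.
rewrite /gray block_shift_castmx !block_shift_row_mx block_shift1 /=.
by congr (castmx _ (row_mx _ (row_mx _ (row_mx _ _))));
   apply/rowP=> j; rewrite !mxE.
Qed.

(** Both [rho] and multiplication by a constant reduce to scaling by [k]: the nilpotent parts of the
    scalar vanish, so no cross terms appear. *)
Lemma gray_semilinear (p alpha beta : nat) (k : 'F_p)
    (x y : mixed p alpha beta) :
  gray (Zpuv k 0 0 *: x + y) = k *: gray x + gray y.
Proof.
rewrite /gray; case: (alpha + _)%N / gray_length; rewrite !castmx_id.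
rewrite !scale_row_mx !add_row_mx.
congr (row_mx _ (row_mx _ (row_mx _ _)));
  apply/rowP=> j; rewrite !mxE //= mul0r addr0 mulrDr;
  by rewrite addrACA.
Qed.

Lemma gray_linear_code (p alpha beta : nat) (C : {set mixed p alpha beta}) :
  submod_closed C -> linear_code [set gray x | x in C].
Proof.
move=> [C0 CP]; split=> [|k _ _ /imsetP[x Cx ->] /imsetP[y Cy ->]].
  apply/imsetP; exists 0 => //.
  (* With scalar -1 and zero vectors this reads [gray 0 = - gray 0 + gray 0], hence [gray 0 = 0]. *)
  have := gray_semilinear (-1) (0 : mixed p alpha beta) 0.
  by rewrite scaler0 addr0 scaleN1r addNr.
by rewrite -gray_semilinear imset_f // CP.
Qed.

Lemma gray_generalized_quasi_cyclic (p alpha beta : nat)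
    (C : {set mixed p alpha beta}) :
  additive_cyclic_code C ->
  generalized_quasi_cyclic_code [:: alpha; beta; beta; beta]
    [set gray x | x in C].
Proof.
move=> [Cmod Cshift]; split; first by rewrite /= addn0 gray_length.
  exact: gray_linear_code.
by move=> _ /imsetP[x Cx ->]; rewrite -gray_cshift imset_f // Cshift.
Qed.

Theorem theorem10 (p alpha beta : nat) (p_prime : prime p)
    (C : {set mixed p alpha beta}) (hC : additive_cyclic_code C) :
  (alpha = beta ->
     quasi_cyclic_code 4 alpha [set gray x | x in C]) /\
  (alpha <> beta ->
     generalized_quasi_cyclic_code [:: alpha; beta; beta; beta]
       [set gray x | x in C]).
Proof.
have [len lin shift] := gray_generalized_quasi_cyclic hC.
(* Once [beta] is replaced by [alpha], [nseq 4 alpha] and the length [4 * alpha] agree with the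
   generalized data by computation. *)
by split=> [eq_ab|_]; split=> //; case: beta / eq_ab in C hC len lin shift *.
Qed.
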